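(* Let $G$ be a finite connected graph, $W$ a positive weight function on $G$ (i.e. $W:V(G)\to\mathbb{Z}$ with $W(q)\ge 1$ for all $q$), and $D$ a distribution on $G$ whose set of distribution nodes relative to $W$, $\{d_1,\ldots,d_n\}=\{q\in V(G): D(q)>W(q)\}$, is nonempty. If $$V_{\{d_1,\ldots,d_n\}}(D)\ \ge\ \max_{i\in[n]} V_{\{d_i\}}(W),$$ then $D$ covers $W$.
   Context: A distribution (or weight function) on $G$ is a function $V(G)\to\mathbb{Z}_{\ge 0}$, interpreted as numbers of pebbles on vertices. For adjacent vertices $p,q$, the pebbling move $P_{p,q}$ sends $D$ to the function equal to $D(p)-2$ at $p$, $D(q)+1$ at $q$, and $D$ elsewhere; it is legal on $D$ if the result is again nonnegative (the identity is also considered a pebbling move). $D'$ is derivable from $D$ if $D'$ is obtained from $D$ by a finite sequence of legal pebbling moves. $D$ is contained in $D'$ if $D(q)\le D'(q)$ for all $q$. $D$ covers $W$ if some distribution derivable from $D$ contains $W$. For nonempty $S\subseteq V(G)$, the standard value is $V_S(D)=\sum_{q\in V(G)} D(q)\,2^{d(q,S)}$, where $d(q,S)=\min_{r\in S} d(q,r)$ and $d$ is graph distance. $[n]=\{1,\ldots,n\}$. *)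

(* Defs.v *)
From Stdlib Require Import Relations.Relation_Operators.
From mathcomp Require Import all_boot.
Set Implicit Arguments.
Unset Strict Implicit.
Unset Printing Implicit Defensive.

(* A finite simple graph is a symmetric irreflexive adjacency relation [e] on
   a finite type of vertices [T]. *)
Definition simple_graph (T : finType) (e : rel T) : Prop :=
  symmetric e /\ irreflexive e.

Definition connected_graph (T : finType) (e : rel T) : Prop :=
  forall x y : T, connect e x y.

Definition has_walk (T : finType) (e : rel T) (x y : T) (n : nat) : bool :=
  [exists p : n.-tuple T, path e x p && (last x p == y)].

(* Least number of edges of a walk from [x] to [y].  Shortest walks have fewer
   than #|T| edges, so the junk value #|T| is taken exactly when [x] and [y]
   are not connected. *)
Definition gdist (T : finType) (e : rel T) (x y : T) : nat :=
  \big[minn/#|T|]_(n < #|T| | has_walk e x y n) (n : nat).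

(* The default #|T| bounds every [gdist], so for nonempty [S] this is the true
   minimum; for empty [S] it is a junk value. *)
Definition gdist_set (T : finType) (e : rel T) (q : T) (S : {set T}) : nat :=
  \big[minn/#|T|]_(r in S) gdist e q r.

Definition distribution (T : finType) := {ffun T -> nat}.

(* The subtraction is truncated; moves are only used under [legal_move]. *)
Definition move (T : finType) (p q : T) (D : distribution T) : distribution T :=
  [ffun x => if x == p then D x - 2 else if x == q then D x + 1 else D x].

(* For p <> q, the value at [p] after the move is the only one that could be
   negative. *)
Definition legal_move (T : finType) (e : rel T) (p q : T)
    (D : distribution T) : bool :=
  e p q && (2 <= D p).

Definition pebbling_step (T : finType) (e : rel T)
    (D D' : distribution T) : Prop :=
  exists p q : T, legal_move e p q D /\ D' = move p q D.

Definition derivable (T : finType) (e : rel T) (D D' : distribution T) : Prop :=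
  clos_refl_trans (distribution T) (pebbling_step e) D D'.

Definition contained (T : finType) (D D' : distribution T) : Prop :=
  forall q : T, D q <= D' q.

Definition covers (T : finType) (e : rel T) (D W : distribution T) : Prop :=
  exists D' : distribution T, derivable e D D' /\ contained W D'.

Definition std_value (T : finType) (e : rel T) (S : {set T})
    (D : distribution T) : nat :=
  \sum_(q : T) D q * 2 ^ gdist_set e q S.

Definition distribution_nodes (T : finType) (D W : distribution T) : {set T} :=
  [set q : T | W q < D q].

(* Main.v *)
(** Call a vertex fat when [W q < D q] and thin when [D q < W q], and let [F] be
    the set of fat vertices.  Take a thin vertex [t] nearest to [F] and a
    shortest path to [t] from a fat vertex [f].  Every vertex of the path before
    [t] carries a pebble, so pushing pebbles along the whole path is legal: it
    removes 2 pebbles from [f], 1 from each interior vertex, and adds 1 to [t].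
    Since 2 + (2 + 4 + ... + 2^(d-1)) = 2^d, the standard value with respect to
    [F] does not change.  No new fat vertex appears, and shrinking [F] can only
    increase the value of the distribution and decrease the maximum on the
    side of [W], so the hypothesis persists with fewer pebbles.  If all fat
    vertices disappear, the distribution lies below [W] and has at least the
    value of [W], hence equals [W]. *)

From Stdlib Require Import Relations.Relation_Operators.
Require Import Defs.
From mathcomp Require Import all_boot zify.

Set Implicit Arguments.
Unset Strict Implicit.
Unset Printing Implicit Defensive.

Lemma leq_bigmin (I : finType) (P : pred I) (F : I -> nat) (k m : nat) :
  (\big[minn/k]_(i | P i) F i <= m) =
  (k <= m) || [exists i, P i && (F i <= m)].
Proof.
have -> : [exists i, P i && (F i <= m)] =
          has (fun i => P i && (F i <= m)) (index_enum I).
  by apply/existsP/hasP => [[i Hi]|[i _ Hi]]; exists i.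
elim: (index_enum I) => [|i r IHr] /=; first by rewrite big_nil orbF.
rewrite big_cons; case: (P i) => //=.
by rewrite geq_min IHr orbCA.
Qed.

Section Distance.

Variables (T : finType) (e : rel T).
Implicit Types (S : {set T}) (D : distribution T) (x y q : T).

(** The bound [n < #|T|] excludes the default value of the minimum, so a small distance must come
    from an actual walk. *)
Lemma gdist_leP x y n : n < #|T| ->
  reflect (exists2 p, path e x p & last x p = y /\ size p <= n)
          (gdist e x y <= n).
Proof.
move=> ltn; rewrite /gdist leq_bigmin leqNgt ltn /=.
apply: (iffP existsP) => [[m /andP[/existsP[p /andP[pth /eqP lst]] lemn]]|].
  by exists p => //; rewrite size_tuple.
case=> p pth [lst szp]; exists (Ordinal (leq_ltn_trans szp ltn)).
by rewrite szp andbT; apply/existsP; exists (in_tuple p); rewrite pth lst /=.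
Qed.

Lemma gdist_set_leP q S n : n < #|T| ->
  reflect (exists2 p, path e q p & last q p \in S /\ size p <= n)
          (gdist_set e q S <= n).
Proof.
move=> ltn; rewrite /gdist_set leq_bigmin leqNgt ltn /=.
apply: (iffP existsP) => [[r /andP[rS /(gdist_leP _ _ ltn)]]|].
  by case=> p pth [lst szp]; exists p => //; rewrite lst.
case=> p pth [lst szp]; exists (last q p); rewrite lst /=.
by apply/(gdist_leP _ _ ltn); exists p.
Qed.

Lemma gdist_setS q S S' : S' \subset S -> gdist_set e q S <= gdist_set e q S'.
Proof.
move=> sub; have := leqnn (gdist_set e q S').
rewrite {1}/gdist_set leq_bigmin /gdist_set leq_bigmin => /orP[->//|].
case/existsP=> r /andP[rS' ler]; apply/orP; right.
by apply/existsP; exists r; rewrite (subsetP sub) // ler.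
Qed.

Lemma gdist_set_eq0 q S : (gdist_set e q S == 0) = (q \in S).
Proof.
have T0 : 0 < #|T| by apply/card_gt0P; exists q.
rewrite -leqn0; apply/(gdist_set_leP q S T0)/idP => [|qS]; last by exists [::].
by case=> [[|y p] _ []].
Qed.

(** A path without repeated vertices has fewer than [#|T|] edges; hence no distance below is a junk
    value. *)
Lemma gdist_set_lt_card q S : connected_graph e -> S != set0 ->
  gdist_set e q S < #|T|.
Proof.
move=> conn /set0Pn[r rS].
have T0 : 0 < #|T| by apply/card_gt0P; exists q.
have /connectP[p0 pth0 lst0] := conn q r.
case/shortenP: pth0 lst0 => p pth uqp _ lst.
have szp : size p < #|T|.
  by rewrite -[_.+1]/(size (q :: p)) -(card_uniqP uqp) max_card.
have T1 : #|T|.-1 < #|T| by rewrite prednK.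
apply: leq_ltn_trans (T1); apply/(gdist_set_leP q S T1).
by exists p => //; rewrite -lst -ltnS prednK.
Qed.

(** Steep paths that start in [S] are shortest paths from [S] to their endpoints. *)
Definition steep S : rel T :=
  [rel x y | e x y && (gdist_set e y S == (gdist_set e x S).+1)].

Lemma steep_pred S y : symmetric e -> connected_graph e -> S != set0 ->
  y \notin S -> exists x, steep S x y.
Proof.
move=> sym conn S0 yS.
have lty := gdist_set_lt_card y conn S0.
have [] := elimT (gdist_set_leP y S lty) (leqnn _).
case=> [|x p] /=; first by move=> _ [yS']; rewrite yS' in yS.
case/andP=> eyx pth [lst szp]; exists x; rewrite /steep /= sym eyx /=.
have lex : gdist_set e x S <= size p.
  by apply/(gdist_set_leP x S (ltn_trans szp lty)); exists p.
(* For the other inequality, a shortest path from [x] to [S] is prolonged by the edge from [y]. *)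
rewrite eqn_leq (leq_ltn_trans lex szp) andbT.
have ltx : gdist_set e x S < #|T| by exact: gdist_set_lt_card.
have [p' pth' [lst' szp']] := elimT (gdist_set_leP x S ltx) (leqnn _).
apply/(gdist_set_leP y S (leq_ltn_trans (leq_ltn_trans lex szp) lty)).
by exists (x :: p') => //=; rewrite eyx.
Qed.

Lemma steep_path S y : symmetric e -> connected_graph e -> S != set0 ->
  exists x p, [/\ x \in S, path (steep S) x p & last x p = y].
Proof.
move=> sym conn S0; move: {2}(gdist_set e y S) (erefl (gdist_set e y S)) => n.
elim: n y => [|n IHn] y dy.
  by exists y, [::]; split=> //; rewrite -gdist_set_eq0 dy.
have yS : y \notin S by rewrite -gdist_set_eq0 dy.
have [z zy] := steep_pred sym conn S0 yS.
have [|x [p [xS pth lst]]] := IHn z; first by case/andP: zy => _; rewrite dy; lia.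
by exists x, (rcons p y); rewrite rcons_path pth lst last_rcons.
Qed.

Lemma steep_path_belast S x p z : path (steep S) x p -> z \in belast x p ->
  gdist_set e z S < gdist_set e (last x p) S.
Proof.
elim: p x z => //= y p IHp x z /andP[/andP[_ /eqP dy] pth].
rewrite inE => /predU1P[->|]; last exact: IHp.
case: p pth IHp => [|y' p] pth IHp; first by rewrite /= dy.
by apply: ltn_trans (IHp y y pth (mem_head _ _)); rewrite dy.
Qed.

Lemma steep_path_uniq S x p : path (steep S) x p -> uniq (x :: p).
Proof.
move=> pth.
have : sorted ltn (map (gdist_set e ^~ S) (x :: p)).
  rewrite sorted_map /=; apply: sub_path pth => a b /andP[_ /eqP].
  by rewrite /= => ->.
move/(sorted_uniq ltn_trans ltnn); exact: map_uniq.
Qed.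

(** A geometric sum: the powers double along the path, and the start counts twice because it pays
    two pebbles. *)
Lemma steep_path_pow S x p : path (steep S) x p ->
  \sum_(z <- belast x p) 2 ^ gdist_set e z S + 2 ^ gdist_set e x S =
  2 ^ gdist_set e (last x p) S.
Proof.
elim: p x => [|y p IHp] x /=; first by rewrite big_nil.
case/andP=> /andP[_ /eqP dy] /IHp <-.
by rewrite big_cons dy expnS; lia.
Qed.

(** Only the start needs two pebbles of its own; each later vertex receives its second one from its
    predecessor. The balance is additive to avoid truncated subtraction. *)
Lemma pushed_path x p D : path e x p -> uniq (x :: p) ->
  {in belast x p, forall z, 2 <= D z + (z != x)} ->
  exists2 D', derivable e D D' &
    forall z, D' z + (z \in belast x p) + (z == x) = D z + (z == last x p).
Proof.
elim: p x D => [|y p IHp] x D; first by exists D => [|z]; [exact: rt_refl|rewrite addn0].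
move=> /= /andP[exy pth] /andP[xyp uyp] HD.
have Dx : 2 <= D x by have := HD x (mem_head _ _); rewrite eqxx addn0.
have nxy : y != x by move: xyp; rewrite inE negb_or eq_sym => /andP[].
have moveE z : move x y D z + (z == x).*2 = D z + (z == y).
  rewrite ffunE; case: (eqVneq z x) => [->|_].
    by rewrite eq_sym (negbTE nxy); lia.
  by case: (z == y); lia.
have xbl : x \notin belast y p.
  by apply: contra xyp => xb; apply: mem_belast.
have [z zb|D' der HD'] := IHp y (move x y D) pth uyp.
  have zx : z != x by apply: contraNneq xbl => <-.
  have := moveE z; have := HD z; rewrite inE zb orbT zx => /(_ isT).
  by rewrite (negbTE zx); case: (z == y); lia.
exists D'.
  by apply: rt_trans der; apply: rt_step; exists x, y; rewrite /legal_move exy.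
move=> z; have := moveE z; have := HD' z; rewrite inE.
case: (eqVneq z x) => [->|_]; last by rewrite /=; lia.
by rewrite (negbTE xbl) /=; lia.
Qed.

(** Weight 1 gives the loss of pebbles, weight [2 ^ gdist_set e z S] the change of the standard
    value. *)
Lemma pushed_path_sum x p D D' (w : T -> nat) : uniq (x :: p) ->
  (forall z, D' z + (z \in belast x p) + (z == x) = D z + (z == last x p)) ->
  \sum_z D' z * w z + (\sum_(z <- belast x p) w z + w x) =
  \sum_z D z * w z + w (last x p).
Proof.
move=> uxp HD'.
have pick1 y : w y = \sum_z (z == y) * w z.
  rewrite (bigD1 y) //= eqxx mul1n big1 ?addn0 // => z.
  by move/negbTE->.
have ub : uniq (belast x p).
  by move: uxp; rewrite lastI rcons_uniq => /andP[].
rewrite (big_uniq _ ub) [X in X + w x]big_mkcond (pick1 x) (pick1 (last x p)).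
rewrite -!big_split /=; apply: eq_bigr => z _.
by rewrite -mulnDl -HD' !mulnDl -addnA; case: ifP; rewrite ?mul1n.
Qed.

Lemma std_valueS S S' D : S' \subset S ->
  std_value e S D <= std_value e S' D.
Proof.
move=> sub; apply: leq_sum => q _.
by rewrite leq_mul2l leq_exp2l // gdist_setS ?orbT.
Qed.

(** All coefficients are positive, so a strict excess at one vertex would make the value strictly
    larger. *)
Lemma contained_std_value_eq S D D' :
  contained D D' -> std_value e S D' <= std_value e S D -> contained D' D.
Proof.
move=> le leV q; rewrite leqNgt; apply/negP => lt.
move: leV; rewrite leqNgt => /negP; apply.
rewrite /std_value (bigD1 q) //= [X in _ < X](bigD1 q) //= -addSn leq_add //.
  by rewrite ltn_mul2r expn_gt0.
by apply: leq_sum => z _; rewrite leq_mul2r le orbT.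
Qed.

End Distance.

Theorem theorem1 (T : finType) (e : rel T) (D W : distribution T)
  (He : simple_graph e)
  (Hconn : connected_graph e)
  (HW : forall q : T, 1 <= W q)
  (HS : distribution_nodes D W != set0)
  (Hval : \max_(d in distribution_nodes D W) std_value e [set d] W
            <= std_value e (distribution_nodes D W) D) :
  covers e D W.
Proof.
have [sym _] := He.
(* Induction on the number of pebbles; the factor 1 matches [pushed_path_sum]. *)
have [n ltn] := ubnP (\sum_z D z * 1); elim: n D ltn HS Hval => // n IHn D.
set F := distribution_nodes D W => ltn F0 Hval.
have [/forallP cont|] := boolP [forall q, W q <= D q].
  by exists D; split=> //; exact: rt_refl.
rewrite negb_forall => /existsP[t0 thin0].
case: (@arg_minnP _ t0 (fun q => ~~ (W q <= D q)) (gdist_set e ^~ F) thin0) => t.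
rewrite -ltnNge => thin tmin.
have [f [p [fF pth lst]]] := steep_path t sym Hconn F0.
have uqp := steep_path_uniq pth.
have notthin z : z \in belast f p -> W z <= D z.
  move=> /(steep_path_belast pth); rewrite lst ltnNge.
  by apply: contraR => /tmin.
have [||D' der HD'] := @pushed_path _ e f p D _ uqp.
- by apply: sub_path pth => a b /andP[].
- move=> z /notthin lez; have := HW z; case: eqVneq => [->|_]; last by lia.
  by move: fF; rewrite inE; have := HW f; lia.
have Dle z : D' z <= D z + (z == t) by have := HD' z; rewrite lst; lia.
have sum1 := pushed_path_sum (fun=> 1) uqp HD'.
have sumV := pushed_path_sum (fun z => 2 ^ gdist_set e z F) uqp HD'.
rewrite (steep_path_pow pth) in sumV.
have {}sumV : std_value e F D' = std_value e F D by exact: addIn sumV.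
(* The push costs [size p] pebbles in total, so the induction needs a nonempty path. *)
have p0 : 0 < size p.
  case: (p) lst => //= ft; move: fF thin; rewrite ft inE; lia.
rewrite sum1_size size_belast in sum1.
(* Only [t] can gain a pebble, and being thin it ends with at most [W t]. *)
have subF : distribution_nodes D' W \subset F.
  apply/subsetP => z; rewrite !inE; have := Dle z.
  by case: eqVneq => [->|_]; lia.
have [F'0|F'0] := eqVneq (distribution_nodes D' W) set0.
  exists D'; split=> //; apply: (@contained_std_value_eq _ e F) => [z|].
    rewrite leqNgt; apply/negP => lt.
    by have := in_set0 z; rewrite -F'0 inE lt.
  (* The value of [W] relative to [F] is at most that relative to [[set f]], which the maximum
     bounds. *)
  rewrite sumV; apply: leq_trans Hval.
  apply: (@leq_trans (std_value e [set f] W)); last exact: leq_bigmax_cond.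
  by apply: std_valueS; rewrite sub1set.
have [|//||E [derE contE]] := IHn D'.
- by lia.
- apply: leq_trans (std_valueS _ _ subF); rewrite sumV.
  apply: leq_trans Hval; apply/bigmax_leqP => d dF'.
  by apply: leq_bigmax_cond; apply: (subsetP subF).
by exists E; split=> //; exact: rt_trans derE.
Qed.
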